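(* Let $m\ge 2$ be an integer, let $z_1,z_2,\dots$ be i.i.d. standard normal random variables, let $I_1,\dots,I_m$ be positive integers, and set $N_1=I_1$, $N_i=N_{i-1}+I_i$ for $i>1$. Let $r_1,\dots,r_m>0$ and define the events $\zeta_i=\{\sum_{j=1}^{N_i} z_j^2>r_i^2\}$, $i=1,\dots,m$. For parameters $u_1^m=(u_1,\dots,u_m)$ with $0\le u_i<1/2$, define recursively $$h_1=u_1,\qquad h_i=h_{i-1}+u_i(1-2h_{i-1}),$$ $$g_1=e^{-u_1 r_m^2}(1-2u_1)^{-I_m/2},\qquad g_i=g_{i-1}\,e^{-u_i(1-2h_{i-1})r_{m-i+1}^2}\,(1-2h_i)^{-I_{m-i+1}/2},$$ so that $1-2h_i=\prod_{j\le i}(1-2u_j)$. Then $$\Pr\left(\bigcap_{i=1}^m\zeta_i\right)\le\inf_{u_1^m}\frac{g_{m-1}(u_1^m)\,\Pr\left(\chi^2_{I_1}>(1-2h_{m-1})r_1^2\right)}{(1-2h_{m-1})^{I_1/2}},$$ the infimum being over all $u_1^m$ with $0\le u_i<1/2$ for all $i$.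
   Context: For a positive integer $k$, $\chi^2_k$ denotes a random variable with the central chi-square distribution with $k$ degrees of freedom. *)

(* Defs.v *)
From HB Require Import structures.
From mathcomp Require Import all_boot all_order all_algebra.
From mathcomp Require Import all_classical all_reals all_analysis.
Set Implicit Arguments. Unset Strict Implicit. Unset Printing Implicit Defensive.
Import Order.TTheory GRing.Theory Num.Theory.
Import numFieldNormedType.Exports.
Local Open Scope classical_set_scope.
Local Open Scope ring_scope.

Definition mutually_independent {d} {T : measurableType d} {R : realType}
  (P : probability T R) (z : nat -> {RV P >-> R}) : Prop :=
  forall (s : seq nat) (B : nat -> set R), uniq s ->
    (forall i, measurable (B i)) ->
    P (\bigcap_(i in [set` s]) (z i @^-1` B i)) =
    (\prod_(i <- s) P (z i @^-1` B i))%E.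

(* z_1, z_2, ... (here z 0, z 1, ...) are i.i.d. standard normal *)
Definition iid_std_normal {d} {T : measurableType d} {R : realType}
  (P : probability T R) (z : nat -> {RV P >-> R}) : Prop :=
  (forall n (A : set R), measurable A ->
     distribution P (z n) A = normal_prob 0 1 A) /\
  mutually_independent z.

Definition chi2_kernel {R : realType} (k : nat) (x : R) : R :=
  x `^ ((k%:R / 2) - 1) * expR (- x / 2).

(* Chi-square distribution with k degrees of freedom (density normalized by
   its total mass, which equals 2^(k/2) Gamma(k/2)). *)
Definition chi2_prob {R : realType} (k : nat) (A : set R) : \bar R :=
  ((fine (\int[lebesgue_measure]_(x in `]0%R, +oo[ : set R) (chi2_kernel k x)%:E))^-1%:E *
   \int[lebesgue_measure]_(x in A `&` (`]0%R, +oo[ : set R)) (chi2_kernel k x)%:E)%E.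

Definition chi2_tail {R : realType} (k : nat) (t : R) : \bar R :=
  chi2_prob k `]t, +oo[.

Definition Ncum (I : nat -> nat) (i : nat) : nat := (\sum_(1 <= j < i.+1) I j)%N.

Fixpoint hseq {R : realType} (u : nat -> R) (n : nat) : R :=
  match n with
  | 0 => 0
  | k.+1 => hseq u k + u k.+1 * (1 - 2 * hseq u k)
  end.

Fixpoint gseq {R : realType} (m : nat) (I : nat -> nat) (r u : nat -> R)
  (n : nat) : R :=
  match n with
  | 0 => 1
  | k.+1 => gseq m I r u k
            * expR (- (u k.+1 * (1 - 2 * hseq u k) * r (m - k)%N ^+ 2))
            * (1 - 2 * hseq u k.+1) `^ (- ((I (m - k)%N)%:R / 2))
  end.

(* the event zeta_i = { sum_{j=1}^{N_i} z_j^2 > r_i^2 } (z_j is z (j-1)) *)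
Definition zeta {d} {T : measurableType d} {R : realType}
  (P : probability T R) (z : nat -> {RV P >-> R}) (I : nat -> nat)
  (r : nat -> R) (i : nat) : set T :=
  [set w | r i ^+ 2 < \sum_(j < Ncum I i) (z j w) ^+ 2].

Definition admissible {R : realType} (m : nat) (u : nat -> R) : Prop :=
  forall i, (1 <= i <= m)%N -> 0 <= u i < 2^-1.

Definition bound {R : realType} (m : nat) (I : nat -> nat) (r u : nat -> R)
  : \bar R :=
  ((gseq m I r u m.-1 / (1 - 2 * hseq u m.-1) `^ ((I 1%N)%:R / 2))%:E
   * chi2_tail (I 1%N) ((1 - 2 * hseq u m.-1) * r 1%N ^+ 2))%E.

(* Main.v *)
Require Import Defs.
From HB Require Import structures.
From mathcomp Require Import all_boot all_order all_algebra.
From mathcomp Require Import all_classical all_reals all_analysis.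
From mathcomp Require Import measurable_realfun ring lra.
Import Order.TTheory GRing.Theory Num.Theory.
Import numFieldNormedType.Exports.
Local Open Scope classical_set_scope.
Local Open Scope ring_scope.

(* Let S_i be the sum of the first N_i squares and c_k = 1 - 2 h_k. Consider
     Q_k = g_k E[1_{zeta_1, ..., zeta_(m-k)} exp (h_k S_(m-k))],
   so that Q_0 is the probability to be bounded. On the outermost event
   zeta_(m-k) the Chernoff factor exp (u_(k+1) c_k (S_(m-k) - r_(m-k)^2)) is at
   least 1; inserting it turns h_k into h_(k+1), and the last block of
   I_(m-k) squares, which is independent of the remaining events, integrates to
   c_(k+1)^(- I_(m-k) / 2). Hence Q_k <= Q_(k+1). In Q_(m-1) only zeta_1 is left
   and the exponential tilting of the chi-square law of S_1 is exact: it rescales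
   the variable by c_(m-1). *)

(** * Lebesgue integrals: densities and substitutions *)

Section density.
Local Open Scope ereal_scope.
Context {d} {T : measurableType d} {R : realType}.
Variables (mu : {measure set T -> \bar R}) (w : T -> R).
Hypothesis mw : measurable_fun setT w.
Hypothesis w0 : forall x, (0 <= w x)%R.

Import HBNNSimple.

(** Packing the density measure as a bundled measure makes uniqueness theorems and pushforwards
    applicable to it; countable additivity is that of the nonnegative integral over disjoint
    unions. *)
Lemma density_measureP : exists m : {measure set T -> \bar R},
  forall A, measurable A -> m A = \int[mu]_(x in A) (w x)%:E.
Proof.
pose m A := \int[mu]_(x in A) (w x)%:E.
have m0 : m set0 = 0 by rewrite /m integral_set0.
have m_ge0 A : 0 <= m A by apply: integral_ge0 => x _; rewrite lee_fin.
have m_sigma : semi_sigma_additive m.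
  move=> F mF tF mUF; rewrite /m ge0_integral_bigcup//.
  - by apply: is_cvg_nneseries => n _ _; apply: m_ge0.
  - by apply/measurable_EFinP; apply: measurable_funS mw.
  - by move=> x _; rewrite lee_fin.
pose mM := isMeasure.Build _ _ _ m m0 m_ge0 m_sigma.
pose M : {measure set T -> \bar R} := HB.pack m mM.
by exists M.
Qed.

(** Both sides are monotone limits along simple functions increasing to [f]; for a simple function
    the claim is the hypothesis on [m] at each level set. *)
Lemma ge0_integral_density (m : {measure set T -> \bar R}) (f : T -> \bar R) :
  (forall A, measurable A -> m A = \int[mu]_(x in A) (w x)%:E) ->
  measurable_fun setT f -> (forall x, 0 <= f x) ->
  \int[m]_x f x = \int[mu]_x (f x * (w x)%:E).
Proof.
move=> mE mf f0; pose h := nnsfun_approx measurableT mf.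
have hf x : (EFin \o h n) x @[n --> \oo] --> f x by exact: cvg_nnsfun_approx.
have hd x : {homo (fun n => (h n x)%:E) : m n / (m <= n)%N >-> m <= n}.
  by move=> a b ab; rewrite lee_fin; exact/lefP/nd_nnsfun_approx.
transitivity (limn (fun n => \int[m]_x (h n x)%:E)).
  rewrite -monotone_convergence//.
  - by apply: eq_integral => x _; apply/esym/cvg_lim => //; exact: hf.
  - by move=> n; exact/measurable_EFinP.
  - by move=> n x _; rewrite lee_fin.
transitivity (limn (fun n => \int[mu]_x ((h n x)%:E * (w x)%:E))); last first.
  rewrite -monotone_convergence//.
  - apply: eq_integral => x _; apply/cvg_lim => //.
    by apply: cvgeZr => //; exact: hf.
  - by move=> n; apply: emeasurable_funM; exact/measurable_EFinP.
  - by move=> n x _; rewrite mule_ge0// lee_fin.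
  - by move=> x _ a b ab; rewrite lee_wpmul2r ?lee_fin ?w0//; exact: hd.
apply: congr_lim; apply/funext => n.
transitivity (\sum_(k \in range (h n)) k%:E * m (h n @^-1` [set k])).
  by rewrite integralT_nnsfun sintegralE.
transitivity (\int[mu]_x (\sum_(k \in range (h n))
    (k * \1_(h n @^-1` [set k]) x)%:E * (w x)%:E)); last first.
  apply: eq_integral => x _; rewrite (fimfunE (h n)) -fsumEFin//.
  rewrite ge0_mule_fsuml// => k; exact: nnfun_muleindic_ge0.
rewrite ge0_integral_fsum//; last 2 first.
  - move=> k; apply: emeasurable_funM; apply/measurable_EFinP => //.
    exact: measurable_funM.
  - by move=> k x _; rewrite mule_ge0 ?lee_fin ?w0//; exact: nnfun_muleindic_ge0.
apply: eq_fsbigr => k /[!inE] -[y _ <-].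
transitivity (\int[mu]_x ((h n y)%:E * ((w \_ (h n @^-1` [set h n y])) x)%:E)).
  rewrite ge0_integralZl_EFin//.
  - by rewrite mE// integral_mkcond; congr (_ * _); apply: eq_integral => x _;
      rewrite !patchE; case: ifP.
  - by move=> x _; rewrite lee_fin patchE; case: ifP.
  - by apply/measurable_EFinP/(measurable_restrictT _ _).1 => //; exact: measurable_funS mw.
apply: eq_integral => x _; rewrite indicE patchE.
by case: ifP => _; rewrite ?mulr1 ?mulr0 ?mule0 ?mul0e.
Qed.

End density.

Section substitution.
Local Open Scope ereal_scope.
Context {R : realType}.
Notation mu := (@lebesgue_measure R).

(** Lebesgue measure is [a] times its pushforward under the affine map; by uniqueness, comparing the
    two on half-open intervals suffices. *)
Lemma ge0_integral_affine (a b : R) (F : R -> \bar R) : (0 < a)%R ->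
  measurable_fun setT F -> (forall x, 0 <= F x) ->
  \int[mu]_x F x = a%:E * \int[mu]_x F (a * x + b)%R.
Proof.
move=> a0 mF F0.
pose phi (x : measurableTypeR R) : measurableTypeR R := (a * x + b)%R.
have mphi : measurable_fun setT phi.
  by apply: measurable_funD => //; exact: measurable_funM.
(* A measure structure on [pushforward mu phi] needs the measurability of [phi]:
   [m0] is a function of that proof. *)
pose m0 : {measure set (measurableTypeR R) -> \bar R} :=
  mscale (NngNum (ltW a0)) (pushforward mu phi).
pose m := m0 mphi.
have muE A : measurable A -> mu A = m A.
  apply: lebesgue_measure_unique => _ [[x y]] /= _ <-.
  rewrite /m /m0/= /mscale/= /pushforward.
  have -> : phi @^-1` `]x, y] = `]((x - b) / a)%R, ((y - b) / a)%R]%classic.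
    apply/seteqP; split => t /=; rewrite !in_itv/= /phi;
      by rewrite ltr_pdivrMr// ler_pdivlMr// ltrBlDr lerBrDr ![(t * a)%R]mulrC.
  rewrite !lebesgue_measure_itv/= !lte_fin ltr_pM2r ?invr_gt0// ltrD2r.
  case: ifPn => xy; last by rewrite mule0.
  by rewrite -!EFinD -EFinM; congr EFin; field; rewrite gt_eqF.
transitivity (\int[m]_x F x).
  by apply: eq_measure_integral => A mA _; exact: muE.
rewrite /m /m0 ge0_integral_mscale//=; congr (_ * _).
by rewrite ge0_integral_pushforward.
Qed.

Lemma ge0_integral_translation (b : R) (F : R -> \bar R) :
  measurable_fun setT F -> (forall x, 0 <= F x) ->
  \int[mu]_x F x = \int[mu]_x F (x + b)%R.
Proof.
move=> mF F0; rewrite (@ge0_integral_affine 1 b)// mul1e.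
by under eq_integral do rewrite mul1r.
Qed.

End substitution.

Section square.
Local Open Scope ereal_scope.
Context {R : realType}.
Notation mu := (@lebesgue_measure R).

Lemma integral_2x (p q : R) : (p <= q)%R ->
  \int[mu]_(x in `]p, q]) (2 * x)%:E = (q ^+ 2 - p ^+ 2)%:E.
Proof.
have c2 : continuous (fun x : R => 2 * x)%R by exact: mulrl_continuous.
have m2 : measurable_fun setT (fun x : R => (2 * x)%:E).
  by apply/measurable_EFinP; exact: measurable_funM.
have d2 x : is_derive x (1 : R)%R (fun x : R => x ^+ 2)%R (2 * x)%R.
  by apply: is_derive_eq; rewrite -mulr2n -[x%:A]/(x * 1)%R mulr1 mulr_natl.
have cs : continuous (fun x : R => x ^+ 2)%R by exact: exprn_continuous.
rewrite le_eqVlt => /predU1P[->|pq].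
  by rewrite set_itvoc0 integral_set0 subrr.
rewrite integral_itv_obnd_cbnd; last exact: measurable_funS m2.
rewrite (@continuous_FTC2 _ _ (fun x => x ^+ 2)%R)//.
- exact: continuous_subspaceT.
- split.
  + by move=> x _; exact: ex_derive.
  + by apply: cvg_at_right_filter; exact: cs.
  + by apply: cvg_at_left_filter; exact: cs.
- by move=> x _; rewrite derive1E; apply: derive_val.
Qed.

(** Lebesgue measure on the positive half-line is the image under squaring of the measure with
    density [2 x] there: the two agree on half-open intervals, hence on all Borel sets. *)
Lemma ge0_integral_square (F : R -> \bar R) :
  measurable_fun setT F -> (forall x, 0 <= F x) ->
  \int[mu]_(x in `]0%R, +oo[) F x =
  \int[mu]_(x in `]0%R, +oo[) (F (x ^+ 2)%R * (2 * x)%:E).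
Proof.
move=> mF F0.
pose w1 : measurableTypeR R -> R := \1_(`]0%R, +oo[).
pose w2 : measurableTypeR R -> R := ((fun x : R => 2 * x) \_ `]0%R, +oo[)%R.
have mw1 : measurable_fun setT w1 by exact: measurable_indic.
have mw2 : measurable_fun setT w2.
  apply/(measurable_restrictT _ _).1 => //.
  by apply: measurable_funTS; exact: measurable_funM.
have w10 x : (0 <= w1 x)%R by rewrite /w1 indicE.
have w20 x : (0 <= w2 x)%R.
  rewrite /w2 patchE; case: ifPn => //; rewrite inE/= in_itv/= andbT => x0.
  by rewrite mulr_ge0// ltW.
have w2E x : (w2 x)%:E = ((fun x : R => (2 * x)%:E) \_ `]0%R, +oo[) x.
  by rewrite /w2 !patchE; case: ifP.
have [m1 m1E] := density_measureP mu w1 mw1 w10.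
have [m2 m2E] := density_measureP mu w2 mw2 w20.
pose sq (x : measurableTypeR R) : measurableTypeR R := (x ^+ 2)%R.
have msq : measurable_fun setT sq by exact: measurable_funX.
pose m30 : {measure set (measurableTypeR R) -> \bar R} := pushforward m2 sq.
pose m3 := m30 msq.
(* [Num.sqrt] is 0 at negative arguments, which is exactly the cut-off of the endpoint at 0; all
   signs of [a] and [b] are thus treated at once. *)
have sqr_max (a : R) : (Num.sqrt a ^+ 2 = Num.max a 0)%R.
  have [a0|a0] := leP 0%R a; first by rewrite sqr_sqrtr.
  by rewrite ltr0_sqrtr// expr0n.
have lt_sqrt (a x : R) : (0 < x)%R -> (Num.sqrt a < x)%R = (a < x ^+ 2)%R.
  move=> x0; have [a0|a0] := leP 0%R a.
    by rewrite -[X in (_ < X)%R = _](ger0_norm (ltW x0)) -sqrtr_sqr ltr_sqrt// exprn_gt0.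
  by rewrite ltr0_sqrtr// x0 (lt_trans a0)// exprn_gt0.
have m13 A : ocitv A -> m1 A = m3 A.
  move=> [[a b] _ <-] /=.
  rewrite m1E// /w1 integral_indic// setIC.
  rewrite /m3 /m30/= /pushforward m2E; last first.
    by rewrite -[X in measurable X]setTI; exact: (msq measurableT).
  under eq_integral do rewrite w2E.
  rewrite -integral_mkcondr.
  have -> : sq @^-1` `]a, b] `&` `]0%R, +oo[ = `](Num.sqrt a), (Num.sqrt b)]%classic.
    apply/seteqP; split => x /=; rewrite !in_itv/= andbT /sq.
      by move=> [/andP[ax xb] x0]; rewrite lt_sqrt// ax leNgt lt_sqrt// -leNgt.
    move=> /andP[ax xb]; have x0 : (0 < x)%R by rewrite (le_lt_trans _ ax)// sqrtr_ge0.
    by rewrite x0 -lt_sqrt// ax leNgt -lt_sqrt// -leNgt.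
  have -> : `]a, b] `&` `]0%R, +oo[ = `](Num.max a 0%R), (Num.max b 0%R)]%classic.
    apply/seteqP; split => x /=; rewrite !in_itv/= andbT gt_max le_max.
      by move=> [/andP[-> ->] ->].
    by move=> /andP[/andP[-> x0] /orP[->//|]]; rewrite leNgt x0.
  rewrite lebesgue_measure_itv/= lte_fin -!sqr_max.
  rewrite ltr_pXn2r ?nnegrE ?sqrtr_ge0//; case: ltP => ab.
    by rewrite integral_2x// ltW.
  by rewrite set_itv_ge ?integral_set0// bnd_simp -leNgt.
(* Extension to Borel sets: the intervals []-n, n]] cover the line and have finite [m1]-mass. *)
have m13E A : measurable A -> m1 A = m3 A.
  apply: (@measure_unique _ R (measurableTypeR R) (@ocitv R)
    (fun n => `](- n%:R)%R, n%:R]%classic) erefl (@ocitvI R)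
    (fun n => is_ocitv _ _) _ m1 m3 m13) => //.
  - rewrite -subTset => x _; exists (Num.truncn `|x|).+1 => //=.
    by have := truncnS_gt `|x|%R; rewrite in_itv/= ltr_norml => /andP[-> /ltW].
  - move=> n; rewrite m1E// /w1 integral_indic//.
    rewrite (@le_lt_trans _ _ (mu `](- n%:R)%R, n%:R])%E)//.
      by rewrite le_measure ?inE//=; exact: measurableI.
    by rewrite lebesgue_measure_itv/=; case: ifPn => // _; rewrite -EFinD ltry.
transitivity (\int[m1]_x F x).
  rewrite (ge0_integral_density mu w1 mw1 w10 m1 F)// [LHS]integral_mkcond.
  apply: eq_integral => x _; rewrite patchE /w1 indicE.
  by case: ifPn => _; rewrite ?mule1 ?mule0.
transitivity (\int[m3]_x F x).
  by apply: eq_measure_integral => A mA _; exact: m13E.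
rewrite /m3 /m30 ge0_integral_pushforward//= preimage_setT.
rewrite (ge0_integral_density mu w2 mw2 w20 m2)//; last first.
  exact: measurableT_comp.
rewrite [RHS]integral_mkcond; apply: eq_integral => x _; rewrite /= /w2 !patchE.
by case: ifPn => _; rewrite ?mule0.
Qed.

End square.

(** * Chi-square laws *)

Section even.
Local Open Scope ereal_scope.
Context {R : realType}.
Notation mu := (@lebesgue_measure R).

Lemma ge0_integral_even (F : R -> \bar R) :
  measurable_fun setT F -> (forall x, 0 <= F x) -> (forall x, F (- x)%R = F x) ->
  \int[mu]_x F x = 2%:E * \int[mu]_(x in `]0%R, +oo[) F x.
Proof.
move=> mF F0 Feven.
have -> : [set: R] = `]-oo, 0%R] `|` `]0%R, +oo[.
  apply/esym; rewrite -subTset => x _ /=; rewrite !in_itv/= andbT.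
  by case: (leP x 0%R) => x0; [left|right].
rewrite ge0_integral_setU//; last 2 first.
- exact: measurable_funTS.
- apply/disj_setPS => x /=; rewrite !in_itv/= andbT => -[x0].
  by rewrite ltNge x0.
rewrite -[X in X + _]/(\int[mu]_(x in `]-oo, 0%R]) F x).
under [X in X + _]eq_integral do rewrite -Feven.
(* Reflection gives the integral over the closed half-line, whose endpoint is a null set. *)
rewrite -ge0_integration_by_substitution0//.
rewrite -integral_itv_obnd_cbnd; last exact: measurable_funTS.
by rewrite -[X in X + _]mul1e -[X in _ + X]mul1e -ge0_muleDl ?lee_fin// -EFinD.
Qed.

End even.

Section chi2_law.
Local Open Scope ereal_scope.
Context {R : realType}.
Notation mu := (@lebesgue_measure R).

(* [powR] takes the junk value 1 at a negative base, so the kernel has to be cut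
   off at 0 before it can be integrated over the whole line. *)
Definition chi2_fun (n : nat) (x : R) : R :=
  if (0 < x)%R then chi2_kernel n x else 0%R.

Lemma chi2_fun_ge0 n x : (0 <= chi2_fun n x)%R.
Proof. by rewrite /chi2_fun; case: ifP => // _; rewrite mulr_ge0 ?powR_ge0 ?expR_ge0. Qed.

Lemma measurable_chi2_fun n : measurable_fun setT (chi2_fun n).
Proof.
apply: measurable_fun_ifT => //; first exact: measurable_fun_ltr.
apply: measurable_funM; first exact: measurable_powR.
by apply: measurableT_comp => //; apply: measurable_funM.
Qed.

Lemma integral_chi2_fun n (A : set R) :
  \int[mu]_(x in A `&` `]0%R, +oo[) (chi2_kernel n x)%:E =
  \int[mu]_(x in A) (chi2_fun n x)%:E.
Proof.
rewrite integral_mkcondr; apply: eq_integral => x _.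
by rewrite patchE/= /chi2_fun mem_setE in_itv/= andbT; case: ifP.
Qed.

(* The normalizing constant is left unspecified: testing against [f = 1] shows
   afterwards that it is the inverse of the total mass. *)
Definition chi2_law {d} {T : measurableType d} (P : probability T R)
    (n : nat) (X : T -> R) : Prop :=
  exists2 C : \bar R, 0 <= C &
    forall f : R -> \bar R, measurable_fun setT f -> (forall x, 0 <= f x) ->
      \int[P]_w f (X w) = C * \int[mu]_x (f x * (chi2_fun n x)%:E).

(** By evenness the positive [x] count twice; substituting [x ^+ 2] on the chi-square side gives the
    Jacobian [2 x]. The factors 2 match, the power -1/2 of [x ^+ 2] cancels [x], and the peak of the
    normal density remains as constant. *)
Lemma chi2_law_sqr {d} {T : measurableType d} (P : probability T R)
    (X : {RV P >-> R}) :
  (forall A, measurable A -> distribution P X A = normal_prob 0 1 A) ->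
  chi2_law P 1 (fun w => X w ^+ 2)%R.
Proof.
move=> Xnormal; exists (normal_peak (1%R : R))%:E.
  by rewrite lee_fin normal_peak_ge0.
move=> f mf f0.
have msq : measurable_fun setT (fun x : R => x ^+ 2)%R by exact: measurable_funX.
have mfsq : measurable_fun setT (fun x : R => f (x ^+ 2)%R).
  exact: (measurableT_comp mf msq).
rewrite -[LHS](ge0_integral_distribution X mfsq)//.
(* [R] and [measurableTypeR R] carry the same Borel sets under two different
   displays, hence the transport along the identity. *)
pose idR : measurableTypeR R -> R := idfun.
have midR : measurable_fun setT idR by exact: measurable_id.
transitivity (\int[pushforward (normal_prob 0 1) idR]_x f (x ^+ 2)%R).
  by apply: eq_measure_integral => A mA _; exact: Xnormal.
rewrite ge0_integral_pushforward//=.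
rewrite (ge0_integral_density mu (normal_pdf 0 1))//; last 2 first.
- exact: measurable_normal_pdf.
- by move=> x; exact: normal_pdf_ge0.
have mfp : measurable_fun setT (fun x : R => f (x ^+ 2)%R * (normal_pdf 0 1 x)%:E).
  apply: emeasurable_funM => //; apply/measurable_EFinP.
  exact: measurable_normal_pdf.
have mfc : measurable_fun setT (fun x : R => f x * (chi2_fun 1 x)%:E).
  by apply: emeasurable_funM => //; apply/measurable_EFinP; exact: measurable_chi2_fun.
have fc0 x : 0 <= f x * (chi2_fun 1 x)%:E.
  by rewrite mule_ge0// lee_fin chi2_fun_ge0.
rewrite ge0_integral_even//; last 2 first.
- by move=> x; rewrite mule_ge0// lee_fin normal_pdf_ge0.
- by move=> x; rewrite sqrrN /normal_pdf oner_eq0 /normal_fun !subr0 sqrrN.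
have -> : \int[mu]_x (f x * (chi2_fun 1 x)%:E) =
          \int[mu]_(x in `]0%R, +oo[) (f x * (chi2_fun 1 x)%:E).
  rewrite [RHS]integral_mkcond; apply: eq_integral => x _.
  rewrite patchE mem_setE in_itv/= andbT /chi2_fun.
  by case: ifP => //; rewrite mule0.
rewrite [in RHS]ge0_integral_square//.
have ZT := @ge0_integralZl _ (measurableTypeR R) R mu `]0%R, +oo[ (measurable_itv _).
rewrite -[LHS]ZT//; last 2 first.
- exact: measurable_funTS.
- by move=> x _; rewrite mule_ge0// lee_fin normal_pdf_ge0.
rewrite -[RHS]ZT ?lee_fin ?normal_peak_ge0//; last 2 first.
- apply: measurable_funTS; apply: emeasurable_funM.
    exact: (measurableT_comp mfc msq).
  by apply/measurable_EFinP; exact: measurable_funM.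
- move=> x; rewrite /= in_itv/= andbT => x0.
  by rewrite mule_ge0// lee_fin mulr_ge0// ltW.
apply: eq_integral => x; rewrite inE/= in_itv/= andbT => x0.
rewrite /chi2_fun exprn_gt0// /normal_pdf oner_eq0 /normal_fun subr0 /chi2_kernel.
rewrite -!muleA [LHS]muleCA [RHS]muleCA; congr (_ * _).
rewrite -!EFinM; congr EFin.
have -> : ((x ^+ 2) `^ (1 / 2 - 1) = x^-1)%R.
  rewrite -powR_mulrn ?ltW// -powRrM -(powR_inv1 (ltW x0)). congr (_ `^ _)%R.
  by field.
rewrite expr1n; field.
by rewrite gt_eqF.
Qed.

End chi2_law.

Section chi2_law_add.
Local Open Scope ereal_scope.
Context {R : realType}.
Notation mu := (@lebesgue_measure R).

(** Integrand of the Beta integral B(n/2, 1/2), cut off outside the open unit interval, where [powR]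
    would take default values. *)
Definition beta_kernel (n : nat) (t : R) : R :=
  (if (0 < t < 1)%R then t `^ (n%:R / 2 - 1) * (1 - t) `^ (1 / 2 - 1) else 0)%R.

Lemma beta_kernel_ge0 n t : (0 <= beta_kernel n t)%R.
Proof. by rewrite /beta_kernel; case: ifP => // _; rewrite mulr_ge0// powR_ge0. Qed.

Lemma measurable_beta_kernel n : measurable_fun setT (beta_kernel n).
Proof.
apply: measurable_fun_ifT => //.
  by apply: measurable_and; exact: measurable_fun_ltr.
apply: measurable_funM; first exact: measurable_powR.
by apply: (measurableT_comp (measurable_powR _)); exact: measurable_funB.
Qed.

(** This is the convolution integrand after x = s t, Jacobian included: the exponentials multiply to
    exp(-s/2), and the exponents of s add up to 1 + (n/2 - 1) + (1/2 - 1) = (n+1)/2 - 1. *)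
Lemma chi2_fun_scale n (s t : R) : (0 < s)%R ->
  (s * (chi2_fun n (s * t) * chi2_fun 1 (s - s * t)) =
   chi2_fun n.+1 s * beta_kernel n t)%R.
Proof.
move=> s0; rewrite /chi2_fun /beta_kernel pmulr_rgt0// s0.
have -> : (s - s * t = s * (1 - t))%R by rewrite mulrBr mulr1.
rewrite pmulr_rgt0// subr_gt0.
case: ifP => t0 /=; last by rewrite mul0r !mulr0.
case: ifP => t1 /=; last by rewrite !mulr0.
rewrite /chi2_kernel !powRM ?ltW ?subr_gt0//.
set a : R := (n%:R / 2)%R.
have -> : (n.+1%:R / 2 - 1 = 1 + (a - 1) + (1 / 2 - 1) :> R)%R.
  by rewrite /a -natr1; field.
have -> : (expR (- s / 2) = expR (- (s * t) / 2) * expR (- (s * (1 - t)) / 2))%R.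
  by rewrite -expRD; congr expR; field.
rewrite !(@powRD _ s) ?(gt_eqF s0) ?implybT// powRr1 ?ltW//.
by ring.
Qed.

(* By homogeneity the convolution is a multiple of the next kernel; the factor is
   a Beta integral whose value (even its finiteness) plays no role. *)
Lemma integral_chi2_fun_conv n (s : R) :
  \int[mu]_x (chi2_fun n x * chi2_fun 1 (s - x))%:E =
  (chi2_fun n.+1 s)%:E * \int[mu]_t (beta_kernel n t)%:E.
Proof.
have [s0|s0] := leP s 0%R.
  (* For s <= 0 one factor always vanishes, since x > 0 and s - x > 0 would force s > 0. *)
  rewrite integral0_eq ?[chi2_fun n.+1 s]/chi2_fun ?ltNge ?s0 ?mul0e// => x _.
  rewrite /chi2_fun; case: ifP => x0; last by rewrite mul0r.
  by rewrite subr_gt0 ltNge (le_trans s0 (ltW x0)) mulr0.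
rewrite (ge0_integral_affine s 0)//; first last.
- by move=> x; rewrite lee_fin mulr_ge0 ?chi2_fun_ge0.
- apply/measurable_EFinP/measurable_funM; first exact: measurable_chi2_fun.
  apply: (measurableT_comp (measurable_chi2_fun _)).
  exact: measurable_funB.
rewrite -!ge0_integralZl//; first last.
- by rewrite lee_fin ltW.
- by move=> x _; rewrite lee_fin mulr_ge0 ?chi2_fun_ge0.
- apply/measurable_EFinP/measurable_funM; apply: (measurableT_comp (measurable_chi2_fun _)).
    by apply: measurable_funD => //; exact: measurable_funM.
  by apply: measurable_funB => //; apply: measurable_funD => //; exact: measurable_funM.
- by rewrite lee_fin chi2_fun_ge0.
- by move=> x _; rewrite lee_fin beta_kernel_ge0.
- by apply/measurable_EFinP; exact: measurable_beta_kernel.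
by apply: eq_integral => x _; rewrite -!EFinM addr0 chi2_fun_scale.
Qed.

Context {d} {T : measurableType d} (P : probability T R).

(** The first hypothesis is independence in integrated form. For fixed [X] the integral over [Y] is
    translated, Tonelli exchanges the order, and [integral_chi2_fun_conv] evaluates the resulting
    convolution. *)
Lemma chi2_law_add n (X Y : T -> R) :
  (forall phi : R * R -> \bar R, measurable_fun setT phi ->
     (forall p, 0 <= phi p) ->
     \int[P]_w phi (X w, Y w) = \int[P]_w \int[P]_v phi (X w, Y v)) ->
  chi2_law P n X -> chi2_law P 1 Y -> chi2_law P n.+1 (fun w => X w + Y w)%R.
Proof.
move=> XY [C C0 XE] [D D0 YE]; exists (C * (D * \int[mu]_t (beta_kernel n t)%:E)).
  by rewrite !mule_ge0// integral_ge0// => t _; rewrite lee_fin beta_kernel_ge0.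
move=> f mf f0.
have mfD : measurable_fun setT (fun p : R * R => f (p.1 + p.2)%R).
  by apply: (measurableT_comp mf); exact: measurable_funD.
rewrite (XY (fun p => f (p.1 + p.2)%R))//=.
pose phi (p : measurableTypeR R * measurableTypeR R) : \bar R :=
  f p.2 * (chi2_fun 1 (p.2 - p.1) * chi2_fun n p.1)%:E.
have mphi : measurable_fun setT phi.
  apply: emeasurable_funM; first exact: (measurableT_comp mf).
  apply/measurable_EFinP/measurable_funM.
    by apply: (measurableT_comp (measurable_chi2_fun _)); exact: measurable_funB.
  by apply: (measurableT_comp (measurable_chi2_fun _)).
have phi0 p : 0 <= phi p by rewrite /phi mule_ge0// lee_fin mulr_ge0// chi2_fun_ge0.
pose psi (p : measurableTypeR R * measurableTypeR R) : \bar R :=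
  f p.2 * (chi2_fun 1 (p.2 - p.1))%:E.
have mpsi : measurable_fun setT psi.
  apply: emeasurable_funM; first exact: (measurableT_comp mf).
  apply/measurable_EFinP.
  by apply: (measurableT_comp (measurable_chi2_fun _)); exact: measurable_funB.
have psi0 p : 0 <= psi p by rewrite /psi mule_ge0// lee_fin chi2_fun_ge0.
(* Up to the factor [D], [G x] is the mean of [f (x + Y)], written in the variable s = x + y. *)
pose G x := \int[mu]_s psi (x, s).
have mG : measurable_fun setT G.
  exact: (measurable_fun_fubini_tonelli_F psi mpsi psi0).
have G0 x : 0 <= G x by apply: integral_ge0.
transitivity (\int[P]_w (D * G (X w))).
  apply: eq_integral => w _ /=.
  have mfX : measurable_fun setT (fun y : R => f (X w + y)%R).
    by apply: (measurableT_comp mf); exact: measurable_funD.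
  have f0X y : 0 <= f (X w + y)%R by [].
  have YEw := YE _ mfX f0X.
  have mpsiX : measurable_fun setT (fun s : measurableTypeR R => psi (X w, s)).
    exact: (measurableT_comp mpsi (measurable_pair1 _)).
  have psi0X s : 0 <= psi (X w, s) by [].
  have GE : G (X w) = \int[mu]_y (f (X w + y)%R * (chi2_fun 1 y)%:E).
    have := ge0_integral_translation (X w) (fun s => psi (X w, s)) mpsiX psi0X.
    rewrite /G => ->.
    by apply: eq_integral => y _; rewrite /psi/= addrK [(X w + y)%R]addrC.
  by rewrite YEw GE.
rewrite (XE (fun x => D * G x)); last 2 first.
- exact: measurable_funeM.
- by move=> x; rewrite mule_ge0.
rewrite -!muleA; congr (_ * _).
transitivity (D * \int[mu]_x \int[mu]_s phi (x, s)).
  rewrite -ge0_integralZl//; last 2 first.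
  - exact: (measurable_fun_fubini_tonelli_F phi mphi phi0).
  - by move=> x _; apply: integral_ge0.
  apply: eq_integral => x _; rewrite -muleA; congr (_ * _).
  rewrite -ge0_integralZr//; last 2 first.
  - exact: (measurableT_comp mpsi (measurable_pair1 _)).
  - by rewrite lee_fin chi2_fun_ge0.
  by apply: eq_integral => s _; rewrite /psi /phi/= EFinM muleA.
congr (_ * _).
rewrite (fubini_tonelli phi mphi phi0).
rewrite -ge0_integralZl//; last 3 first.
- by apply: emeasurable_funM => //; apply/measurable_EFinP; exact: measurable_chi2_fun.
- by move=> x _; rewrite mule_ge0// lee_fin chi2_fun_ge0.
- by apply: integral_ge0 => t _; rewrite lee_fin beta_kernel_ge0.
apply: eq_integral => s _.
pose k x : \bar R := (chi2_fun n x * chi2_fun 1 (s - x))%:E.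
have mk : measurable_fun setT k.
  apply/measurable_EFinP/measurable_funM; first exact: measurable_chi2_fun.
  by apply: (measurableT_comp (measurable_chi2_fun _)); exact: measurable_funB.
have k0 x : 0 <= k x by rewrite lee_fin mulr_ge0// chi2_fun_ge0.
transitivity (\int[mu]_x (f s * k x)).
  by apply: eq_integral => x _; rewrite /phi/= [(chi2_fun 1 _ * _)%R]mulrC.
have kE : \int[mu]_x k x = _ := integral_chi2_fun_conv n s.
have -> : \int[mu]_x (f s * k x) = f s * \int[mu]_x k x.
  exact: (ge0_integralZl mu measurableT mk (fun x _ => k0 x) (f0 s)).
by rewrite kE muleA muleC.
Qed.

End chi2_law_add.

Section chi2_law_tilt.
Local Open Scope ereal_scope.
Context {R : realType} {d} {T : measurableType d} (P : probability T R).
Notation mu := (@lebesgue_measure R).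

Lemma chi2_probE n (A : set R) :
  chi2_prob n A =
  ((fine (\int[mu]_x (chi2_fun n x)%:E))^-1)%:E * \int[mu]_(x in A) (chi2_fun n x)%:E.
Proof.
by rewrite /chi2_prob integral_chi2_fun -[X in fine (integral _ X _)]setTI integral_chi2_fun.
Qed.

(** Testing the law against the constant 1 identifies [C] as the inverse of the mass of the
    kernel. *)
Lemma chi2_law_prob n (X : T -> R) (f : R -> \bar R) : chi2_law P n X ->
  measurable_fun setT f -> (forall x, 0 <= f x) ->
  \int[P]_w f (X w) =
  ((fine (\int[mu]_x (chi2_fun n x)%:E))^-1)%:E * \int[mu]_x (f x * (chi2_fun n x)%:E).
Proof.
move=> [C C0 XE] mf f0; rewrite XE//; congr (_ * _).
set M := \int[mu]_x (chi2_fun n x)%:E.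
have M0 : 0 <= M by apply: integral_ge0 => x _; rewrite lee_fin chi2_fun_ge0.
have : C * M = 1.
  have /= := XE (cst 1) (measurable_cst _) (fun=> lee01).
  rewrite integral_cst//= mul1e probability_setT => ->; congr (_ * _).
  by apply: eq_integral => x _; rewrite mul1e.
(* In the extended reals an infinite [C] or [M] would make the product 0 or infinite, so both are
   finite. *)
move: C M C0 M0 {XE} => [c| |//] [m| |//]; rewrite ?lee_fin /= => c0 m0.
- rewrite -EFinM => -[cm1]; congr EFin.
  have m_neq0 : m != 0%R by apply: contra_eq_neq cm1 => ->; rewrite mulr0 eq_sym oner_eq0.
  by rewrite -[LHS](mulfK m_neq0) cm1 mul1r.
- have [->|] := eqVneq c 0%R; first by rewrite mul0e => -[/eqP]; rewrite eq_sym oner_eq0.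
  by rewrite neq_lt ltNge c0/= => c_gt0; rewrite gt0_muley.
- have [->|] := eqVneq m 0%R; first by rewrite mule0 => -[/eqP]; rewrite eq_sym oner_eq0.
  by rewrite neq_lt ltNge m0/= => m_gt0; rewrite gt0_mulye.
- by rewrite mulyy.
Qed.

Lemma chi2_law_setT n (X : T -> R) : chi2_law P n X -> chi2_prob n [set: R] = 1.
Proof.
move=> XE; rewrite chi2_probE.
have := chi2_law_prob n X (cst 1) XE (measurable_cst _) (fun=> lee01).
rewrite integral_cst//= mul1e probability_setT => ->; congr (_ * _).
by apply: eq_integral => x _; rewrite mul1e.
Qed.

(** With c = 1 - 2 h and x = y / c, the exponents combine as h x - x / 2 = - y / 2, while the
    Jacobian and the power of x contribute c^(- n/2). *)
Lemma chi2_fun_tilt n (h y : R) : (h < 2^-1)%R ->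
  ((1 - 2 * h)^-1 * (expR (h * ((1 - 2 * h)^-1 * y)) *
     chi2_fun n ((1 - 2 * h)^-1 * y)) =
   (1 - 2 * h) `^ (- (n%:R / 2)) * chi2_fun n y)%R.
Proof.
move=> h2; set c := (1 - 2 * h)%R.
have c0 : (0 < c)%R by rewrite /c; lra.
have cN0 : c != 0%R by rewrite gt_eqF.
rewrite /chi2_fun pmulr_rgt0 ?invr_gt0//; case: ifP => y0; last by rewrite !mulr0.
rewrite /chi2_kernel powRM ?invr_ge0 ?ltW//.
have -> : ((1 - 2 * h) `^ (- (n%:R / 2)) = c^-1 * c^-1 `^ (n%:R / 2 - 1))%R.
  rewrite -/c -[in RHS](powR_inv1 (ltW c0)) -powRrM -powRD ?cN0 ?implybT//.
  by congr (_ `^ _)%R; ring.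
have -> : expR (- y / 2) = (expR (h * (c^-1 * y)) * expR (- (c^-1 * y) / 2))%R.
  rewrite -expRD; congr expR.
  have -> : h = ((1 - c) / 2)%R by rewrite /c; field.
  by field.
by ring.
Qed.

(** The substitution x = y / c absorbs the tilt into the kernel. Taking the whole line for [A] gives
    the moment generating function; a half-line gives the rescaled tail of the final bound. *)
Lemma chi2_law_tilt n (X : T -> R) (h : R) (A : set R) :
  measurable_fun setT X -> measurable A -> (h < 2^-1)%R -> chi2_law P n X ->
  \int[P]_(w in X @^-1` A) (expR (h * X w))%:E =
  ((1 - 2 * h) `^ (- (n%:R / 2)))%:E *
  chi2_prob n [set y | A ((1 - 2 * h)^-1 * y)%R].
Proof.
move=> mX mA h2 XE; set c := (1 - 2 * h)%R.
have c0 : (0 < c)%R by rewrite /c; lra.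
pose f : R -> \bar R := (fun x => (expR (h * x))%:E) \_ A.
have mf : measurable_fun setT f.
  apply/(measurable_restrictT _ _).1 => //; apply: measurable_funTS.
  by apply/measurable_EFinP; apply: measurableT_comp => //; exact: measurable_funM.
have f0 x : 0 <= f x by rewrite /f patchE; case: ifP => // _; rewrite lee_fin expR_ge0.
transitivity (\int[P]_w f (X w)).
  by rewrite integral_mkcond; apply: eq_integral => w _; rewrite /f !patchE.
rewrite (chi2_law_prob n X f XE)// chi2_probE muleCA; congr (_ * _).
have mfc : measurable_fun setT (fun x => f x * (chi2_fun n x)%:E).
  by apply: emeasurable_funM => //; apply/measurable_EFinP; exact: measurable_chi2_fun.
rewrite (ge0_integral_affine c^-1 0) ?invr_gt0//; last first.
  by move=> x; rewrite mule_ge0// lee_fin chi2_fun_ge0.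
rewrite [X in _ = _ * X]integral_mkcond.
have mA' : measurable [set y : R | A (c^-1 * y)%R].
  rewrite -[X in measurable X]setTI.
  by apply: (_ : measurable_fun setT (fun y : R => c^-1 * y)%R) => //; exact: measurable_funM.
rewrite -[LHS]ge0_integralZl//; last 3 first.
- apply: (measurableT_comp mfc).
  by apply: measurable_funD => //; exact: measurable_funM.
- by move=> x _; rewrite mule_ge0// lee_fin chi2_fun_ge0.
- by rewrite lee_fin invr_ge0 ltW.
rewrite -[RHS]ge0_integralZl//; last 3 first.
- apply/(measurable_restrictT _ _).1 => //; apply: measurable_funTS.
  by apply/measurable_EFinP; exact: measurable_chi2_fun.
- by move=> x _; rewrite patchE; case: ifP => // _; rewrite lee_fin chi2_fun_ge0.
- by rewrite lee_fin powR_ge0.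
apply: eq_integral => y _; rewrite addr0 /f !patchE.
have -> : (y \in [set y : R | A (c^-1 * y)%R]) = (c^-1 * y \in A)%R.
  by apply/idP/idP; rewrite !inE.
case: ifP => _; last by rewrite mul0e !mule0.
by rewrite -!EFinM chi2_fun_tilt.
Qed.

End chi2_law_tilt.

(** * Independence from the past *)

Section independence.
Local Open Scope ereal_scope.
Context {R : realType} {d} {T : measurableType d} (P : probability T R).

(** The joint law agrees with the product of the marginals on rectangles, hence everywhere; Tonelli
    then applies. *)
Lemma ge0_integral_indep (X Y : T -> R) (phi : R * R -> \bar R) :
  measurable_fun setT X -> measurable_fun setT Y ->
  (forall A B, measurable A -> measurable B ->
    P (X @^-1` A `&` Y @^-1` B) = P (X @^-1` A) * P (Y @^-1` B)) ->
  measurable_fun setT phi -> (forall p, 0 <= phi p) ->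
  \int[P]_w phi (X w, Y w) = \int[P]_w \int[P]_v phi (X w, Y v).
Proof.
move=> mX mY XY mphi phi0.
pose XM : {mfun T >-> R} := HB.pack X (isMeasurableFun.Build _ _ _ _ X mX).
pose YM : {mfun T >-> R} := HB.pack Y (isMeasurableFun.Build _ _ _ _ Y mY).
pose XYf w := (X w, Y w).
have mXY : measurable_fun setT XYf by exact: measurable_fun_pair.
pose XYM : {mfun T >-> (R * R)%type} :=
  HB.pack XYf (isMeasurableFun.Build _ _ _ _ XYf mXY).
transitivity (\int[distribution P XYM]_p phi p).
  by rewrite ge0_integral_distribution.
transitivity (\int[distribution P XM \x distribution P YM]_p phi p).
  apply: eq_measure_integral => A mA _; apply/esym.
  by apply: product_measure_unique => // B C mB mC; exact: XY.
rewrite fubini_tonelli1// ge0_integral_distribution//; last 2 first.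
- exact: (measurable_fun_fubini_tonelli_F phi mphi phi0).
- by move=> x; exact: integral_ge0.
apply: eq_integral => w _ /=.
rewrite /fubini_F ge0_integral_distribution//.
exact: (measurableT_comp mphi (measurable_pair1 _)).
Qed.

Variable z : nat -> {RV P >-> R}.

(** Boxes in [z 0, ..., z n.-1]: a generating class closed under intersection, on which independence
    is checked before being extended by uniqueness of measures. *)
Definition cylinder (n : nat) : set (set T) :=
  [set A | exists2 B : nat -> set R, (forall i, measurable (B i)) &
    A = \bigcap_(i in [set` iota 0 n]) (z i @^-1` B i)].

Lemma cylinder_measurable n : cylinder n `<=` measurable.
Proof.
move=> _ [B mB ->]; apply: bigcap_measurableType => //= i _.
exact: measurable_funPTI.
Qed.

Lemma cylinderI n : setI_closed (cylinder n).
Proof.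
move=> _ _ [A mA ->] [B mB ->]; exists (fun i => A i `&` B i) => [i|].
  exact: measurableI.
by rewrite -bigcapI.
Qed.

Lemma cylinderT n : cylinder n setT.
Proof. by exists (fun=> setT) => //; rewrite bigcapT. Qed.

Lemma cylinder_le m n : (m <= n)%N -> cylinder m `<=` cylinder n.
Proof.
move=> mn _ [B mB ->]; exists (fun i => if (i < m)%N then B i else setT) => [i|].
  by case: ifP.
apply/seteqP; split => w /= Bw i /=.
  rewrite mem_iota/= => _; case: ifPn => // im; apply: Bw => /=.
  by rewrite mem_iota.
rewrite mem_iota/= => im; have := Bw i; rewrite /= im; apply.
by rewrite mem_iota (leq_trans im).
Qed.

(** The sigma-algebra of the first [n] variables, as a second measurable structure on [T], so that
    dependence on the past alone is an ordinary [measurable_fun]. *)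
Definition past n := g_sigma_algebraType (cylinder n).

Lemma measurable_past n (X : T -> R) :
  measurable_fun (setT : set (past n)) X -> measurable_fun setT X.
Proof.
move=> mX _ Y mY; have := mX measurableT Y mY.
rewrite /measurable/=; apply: smallest_sub => //; first exact: sigma_algebra_measurable.
exact: cylinder_measurable.
Qed.

Lemma past_le m n (X : T -> R) : (m <= n)%N ->
  measurable_fun (setT : set (past m)) X -> measurable_fun (setT : set (past n)) X.
Proof.
move=> mn mX _ Y mY; have := mX measurableT Y mY.
by apply: sub_sigma_algebra2; exact: cylinder_le.
Qed.

Lemma past_rv n i : (i < n)%N -> measurable_fun (setT : set (past n)) (z i).
Proof.
move=> im _ Y mY; rewrite setTI; apply: sub_sigma_algebra.
exists (fun j => if j == i then Y else setT) => [j|]; first by case: ifP.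
apply/seteqP; split => w /= Yw.
  by move=> j _ /=; case: eqP => // ->.
by have := Yw i; rewrite /= eqxx; apply; rewrite mem_iota.
Qed.

Hypothesis zI : mutually_independent z.

Lemma cylinder_indep n A (B : set R) : cylinder n A -> measurable B ->
  P (A `&` z n @^-1` B) = P A * P (z n @^-1` B).
Proof.
move=> [C mC ->] mB.
(* Index [n] is unconstrained in a box of [cylinder n], so the family can be set to [B] there;
   independence is used for [n :: iota 0 n] and for [iota 0 n]. *)
pose D i := if i == n then B else C i.
have mD i : measurable (D i) by rewrite /D; case: ifP.
have DE : {in iota 0 n, forall i, D i = C i}.
  by move=> i; rewrite mem_iota/= /D => /ltn_eqF ->.
have -> : \bigcap_(i in [set` iota 0 n]) (z i @^-1` C i) `&` z n @^-1` B =
          \bigcap_(i in [set` n :: iota 0 n]) (z i @^-1` D i).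
  apply/seteqP; split => w /=.
    move=> [Cw Bw] i /=; rewrite inE => /predU1P[->|im]; first by rewrite /D eqxx.
    by rewrite DE//; exact: Cw.
  move=> Dw; split.
    by move=> i /= im; rewrite -DE//; apply: Dw; rewrite /= inE im orbT.
  by have := Dw n; rewrite /D eqxx; apply; rewrite /= mem_head.
rewrite zI//=; last by rewrite iota_uniq mem_iota/= ltnn.
have Dn : D n = B by rewrite /D eqxx.
rewrite big_cons Dn zI ?iota_uniq// muleC; congr (_ * _).
by apply: eq_big_seq => i im; rewrite DE.
Qed.

(** For fixed [B], restricting [P] to the event on [z n] and scaling [P] by its probability give two
    measures; they agree on cylinders, hence on the sigma-algebra generated by them. *)
Lemma past_indep n (X : T -> R) (A B : set R) :
  measurable_fun (setT : set (past n)) X -> measurable A -> measurable B ->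
  P (X @^-1` A `&` z n @^-1` B) = P (X @^-1` A) * P (z n @^-1` B).
Proof.
move=> mX mA mB.
have mzB : measurable (z n @^-1` B) by exact: measurable_funPTI.
have Pfin : P (z n @^-1` B) \is a fin_num by exact: fin_num_measure.
have P0 : (0 <= fine (P (z n @^-1` B)))%R by rewrite fine_ge0.
pose m1 : {measure set T -> \bar R} := mrestr P mzB.
pose m2 : {measure set T -> \bar R} := mscale (NngNum P0) P.
have m12 E : <<s cylinder n >> E -> m1 E = m2 E.
  apply: (g_sigma_algebra_measure_unique (cylinder n) _ (fun=> setT)).
  - exact: cylinder_measurable.
  - by move=> _; exact: cylinderT.
  - by rewrite -subTset => w _; exists 0%N.
  - exact: cylinderI.
  - move=> E' En; rewrite /m1 /m2 /= /mrestr /mscale/= fineK// muleC.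
    exact: cylinder_indep.
  - move=> _; rewrite /m1/= /mrestr setTI.
    by rewrite (le_lt_trans (probability_le1 P mzB))// ltry.
have := m12 (X @^-1` A); rewrite /m1 /m2/= /mrestr /mscale/= fineK// muleC; apply.
by rewrite -[X in _ X]setTI; exact: (mX measurableT).
Qed.

End independence.

(** * Sums of squares of standard normal variables *)

Section gaussian_sums.
Local Open Scope ereal_scope.
Context {R : realType} {d} {T : measurableType d} (P : probability T R).
Variable z : nat -> {RV P >-> R}.
Hypothesis z_iid : iid_std_normal z.

Definition psum n (w : T) : R := (\sum_(j < n) z j w ^+ 2)%R.

Lemma psumS n w : psum n.+1 w = (psum n w + z n w ^+ 2)%R.
Proof. by rewrite /psum big_ord_recr. Qed.

Lemma psum_past n : measurable_fun (setT : set (past P z n)) (psum n).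
Proof.
apply: measurable_sum => j; apply: measurable_funX.
exact: past_rv.
Qed.

Lemma sqr_chi2_law n : chi2_law P 1 (fun w => z n w ^+ 2)%R.
Proof. by apply: chi2_law_sqr => A; apply: z_iid.1. Qed.

(** With indices starting at 0, [z n] is the first variable outside [past n]; its square can be
    averaged with the past frozen. *)
Lemma integral_past_sqr n (X : T -> R) (phi : R * R -> \bar R) :
  measurable_fun (setT : set (past P z n)) X ->
  measurable_fun setT phi -> (forall p, 0 <= phi p) ->
  \int[P]_w phi (X w, (z n w ^+ 2)%R) =
  \int[P]_w \int[P]_v phi (X w, (z n v ^+ 2)%R).
Proof.
move=> mX mphi phi0.
apply: (ge0_integral_indep P X (fun w => z n w ^+ 2)%R) => //.
- exact: measurable_past mX.
- exact: measurable_funX.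
- move=> A B mA mB.
  have mB' : measurable ((fun x : R => x ^+ 2)%R @^-1` B).
    rewrite -[X in measurable X]setTI.
    by apply: (_ : measurable_fun setT (fun x : R => x ^+ 2)%R) => //; exact: measurable_funX.
  exact: (past_indep P z z_iid.2 n X A _ mX mA mB').
Qed.

Lemma psum_chi2_law n : (0 < n)%N -> chi2_law P n (psum n).
Proof.
(* The induction starts at one square: the empty sum is a point mass at 0, without density. *)
case: n => // n _; elim: n => [|n IH].
  have -> : psum 1 = (fun w => z 0%N w ^+ 2)%R.
    by apply/funext => w; rewrite psumS /psum big_ord0 add0r.
  exact: sqr_chi2_law.
have -> : psum n.+2 = (fun w => psum n.+1 w + z n.+1 w ^+ 2)%R.
  by apply/funext => w; rewrite psumS.
have indep phi : measurable_fun setT phi -> (forall p, 0 <= phi p) ->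
    \int[P]_w phi (psum n.+1 w, (z n.+1 w ^+ 2)%R) =
    \int[P]_w \int[P]_v phi (psum n.+1 w, (z n.+1 v ^+ 2)%R).
  exact: (integral_past_sqr n.+1 (psum n.+1) phi (psum_past n.+1)).
exact: (chi2_law_add P n.+1 (psum n.+1) (fun w => z n.+1 w ^+ 2)%R
  indep IH (sqr_chi2_law n.+1)).
Qed.

Lemma integral_expR_sqr n (h : R) : (h < 2^-1)%R ->
  \int[P]_w (expR (h * z n w ^+ 2))%:E = ((1 - 2 * h) `^ (- (1 / 2)))%:E.
Proof.
move=> h2; have zn := sqr_chi2_law n.
have mz : measurable_fun setT (fun w => z n w ^+ 2)%R by exact: measurable_funX.
have := chi2_law_tilt P 1 _ h setT mz measurableT h2 zn.
by rewrite preimage_setT => ->; rewrite (chi2_law_setT P 1 _ zn) mule1.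
Qed.

Lemma integral_past_expR_sqr n (X : T -> R) (h : R) :
  measurable_fun (setT : set (past P z n)) X -> (forall w, (0 <= X w)%R) ->
  (h < 2^-1)%R ->
  \int[P]_w (X w * expR (h * z n w ^+ 2))%:E =
  \int[P]_w (X w)%:E * ((1 - 2 * h) `^ (- (1 / 2)))%:E.
Proof.
move=> mX X0 h2.
(* The absolute value makes [phi] nonnegative on the whole plane and changes nothing on the values
   of [X]. *)
pose phi (p : R * R) : \bar R := (`|p.1| * expR (h * p.2))%:E.
have mphi : measurable_fun setT phi.
  apply/measurable_EFinP/measurable_funM; first exact: measurableT_comp.
  by apply: measurableT_comp => //; exact: measurable_funM.
have phi0 p : 0 <= phi p by rewrite lee_fin mulr_ge0// expR_ge0.
transitivity (\int[P]_w phi (X w, (z n w ^+ 2)%R)).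
  by apply: eq_integral => w _; rewrite /phi/= ger0_norm.
rewrite (integral_past_sqr n X phi mX mphi phi0).
rewrite -ge0_integralZr//; last 3 first.
- by apply/measurable_EFinP; exact: measurable_past mX.
- by move=> w _; rewrite lee_fin.
- by rewrite lee_fin powR_ge0.
apply: eq_integral => w _; rewrite -(integral_expR_sqr n h h2) -ge0_integralZl//.
- by apply: eq_integral => v _; rewrite /phi/= ger0_norm// EFinM.
- apply/measurable_EFinP; apply: measurableT_comp => //.
  by apply: measurable_funM => //; exact: measurable_funX.
- by rewrite lee_fin.
Qed.

(** The squares are peeled off from the last one, each contributing (1 - 2 h)^(- 1/2). *)
Lemma integral_past_expR_psum n k (X : T -> R) (h : R) :
  measurable_fun (setT : set (past P z n)) X -> (forall w, (0 <= X w)%R) ->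
  (h < 2^-1)%R ->
  \int[P]_w (X w * expR (h * psum (n + k) w))%:E =
  \int[P]_w (X w * expR (h * psum n w))%:E * ((1 - 2 * h) `^ (- (k%:R / 2)))%:E.
Proof.
move=> mX X0 h2; elim: k => [|k IH].
  by rewrite addn0 mul0r oppr0 powRr0 mule1.
have c0 : (1 - 2 * h != 0)%R by apply/eqP; lra.
have -> : (- (k.+1%:R / 2) = - (k%:R / 2) + - (1 / 2) :> R)%R.
  by rewrite -natr1; field.
rewrite powRD ?c0 ?implybT// EFinM muleA -IH addnS.
(* [Y] gathers the weight and the earlier squares; it depends on the first [n + k] variables only,
   hence is independent of [z (n + k)]. *)
pose Y w : R := (X w * expR (h * psum (n + k) w))%R.
have mY : measurable_fun (setT : set (past P z (n + k))) Y.
  apply: measurable_funM; first exact: (past_le P z n (n + k) X (leq_addr _ _) mX).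
  apply: measurableT_comp => //; apply: measurable_funM => //.
  exact: psum_past.
have Y0 w : (0 <= Y w)%R by rewrite mulr_ge0// expR_ge0.
rewrite -(integral_past_expR_sqr (n + k) Y h mY Y0 h2).
by apply: eq_integral => w _; rewrite /Y psumS mulrDr expRD mulrA.
Qed.

End gaussian_sums.

(** * The iterated Chernoff bound *)

Section staircase_bound.
Context {R : realType} {d} {T : measurableType d} (P : probability T R).
Variables (z : nat -> {RV P >-> R}) (m : nat) (I : nat -> nat) (r u : nat -> R).
Hypothesis m2 : (2 <= m)%N.
Hypothesis z_iid : iid_std_normal z.
Hypothesis I0 : forall i, (1 <= i <= m)%N -> (0 < I i)%N.
Hypothesis u_adm : admissible m u.

Lemma one_sub_hseq k :
  1 - 2 * hseq u k.+1 = (1 - 2 * hseq u k) * (1 - 2 * u k.+1).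
Proof. by rewrite /=; ring. Qed.

Lemma one_sub_hseq_gt0 k : (k <= m)%N -> 0 < 1 - 2 * hseq u k.
Proof.
elim: k => [|k IH] km; first by rewrite mulr0 subr0.
rewrite one_sub_hseq mulr_gt0// ?IH 1?ltnW//.
by have /andP[_] := u_adm k.+1 km; lra.
Qed.

Lemma hseq_lt k : (k <= m)%N -> hseq u k < 2^-1.
Proof. by move=> /one_sub_hseq_gt0; lra. Qed.

Lemma gseq_ge0 k : 0 <= gseq m I r u k.
Proof. by elim: k => //= k IH; rewrite !mulr_ge0// ?expR_ge0 ?powR_ge0. Qed.

Lemma NcumS i : Ncum I i.+1 = (Ncum I i + I i.+1)%N.
Proof. by rewrite /Ncum big_nat_recr. Qed.

Lemma Ncum_le i j : (i <= j)%N -> (Ncum I i <= Ncum I j)%N.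
Proof.
move=> /subnK <-; elim: (j - i)%N => // k IH.
by rewrite addSn NcumS (leq_trans IH)// leq_addr.
Qed.

Definition exceed k : set T := \bigcap_(i in [set i | (1 <= i <= k)%N]) zeta z I r i.

Lemma exceedS k : exceed k.+1 = exceed k `&` zeta z I r k.+1.
Proof.
apply/seteqP; split => [w Ew|w [Ew Zw] i /= /andP[i1]].
  split; last by apply: Ew => /=.
  by move=> i /= /andP[i1 ik]; apply: Ew; rewrite /= i1 ltnW.
by rewrite leq_eqVlt => /predU1P[->//|ik]; apply: Ew; rewrite /= i1.
Qed.

Lemma exceed1 : exceed 1 = [set w | r 1%N ^+ 2 < psum P z (I 1%N) w].
Proof.
have N1 : Ncum I 1 = I 1%N by rewrite /Ncum big_nat1.
rewrite exceedS /zeta N1 -[RHS]setTI; congr (_ `&` _).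
by apply/seteqP; split => // w _ i /= /andP[i1]; rewrite leqn0 => /eqP i0; rewrite i0 in i1.
Qed.

(** For i <= k the event [zeta] of index i involves only the first [Ncum I i <= Ncum I k]
    variables. *)
Lemma exceed_past k :
  measurable_fun (setT : set (past P z (Ncum I k))) (\1_(exceed k) : T -> R).
Proof.
apply: (@measurable_indic _ (past P z (Ncum I k))).
apply: (@bigcap_measurableType _ (past P z (Ncum I k))) => i /= /andP[_ ik].
have mp : measurable_fun (setT : set (past P z (Ncum I k))) (psum P z (Ncum I i)).
  exact: (past_le P z _ _ _ (Ncum_le _ _ ik) (psum_past P z _)).
have := mp measurableT `]r i ^+ 2, +oo[%classic (measurable_itv _).
rewrite setTI; congr (measurable _).
by apply/seteqP; split => w /=; rewrite in_itv/= andbT.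
Qed.

Local Open Scope ereal_scope.

(** Multiplied by [gseq m I r u k], the value [tilted (m - k) (hseq u k)] is the quantity Q_k of the
    outline. *)
Definition tilted k h : \bar R :=
  \int[P]_w (\1_(exceed k) w * expR (h * psum P z (Ncum I k) w))%:E.

(** The cutoff [n] is separate from [k] because in [tilted_step] the exponent keeps one block more
    than the events. *)
Lemma measurable_tilted n k h :
  measurable_fun setT (fun w => \1_(exceed k) w * expR (h * psum P z n w))%R.
Proof.
apply: measurable_funM; first exact: (measurable_past P z _ _ (exceed_past k)).
apply: measurableT_comp => //; apply: measurable_funM => //.
exact: (measurable_past P z _ _ (psum_past P z n)).
Qed.

Lemma tilted0 k : tilted k 0%R = P (exceed k).
Proof.
have mE : measurable (exceed k).
  have := measurable_past P z _ _ (exceed_past k) measurableT [set 1%R] (measurable_set1 _).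
  rewrite setTI; congr (measurable _); apply/seteqP; split => w /=.
    by rewrite indicE; case: (boolP (w \in _)) => [/set_mem//|_ /eqP]; rewrite eq_sym oner_eq0.
  by move=> Ew; rewrite indicE mem_set.
rewrite -[X in _ = P X](setIT (exceed k)) -integral_indic//; apply: eq_integral => w _.
by rewrite mul0r expR0 mulr1.
Qed.

Lemma tilted_step k : (k.+1 < m)%N ->
  (gseq m I r u k)%:E * tilted (m - k) (hseq u k) <=
  (gseq m I r u k.+1)%:E * tilted (m - k.+1) (hseq u k.+1).
Proof.
move=> km; have mkE : (m - k = (m - k.+1).+1)%N by rewrite subnSK// ltnW.
rewrite /= !EFinM -!muleA lee_wpmul2l// ?lee_fin ?gseq_ge0//.
set h := hseq u k; set v := u k.+1; set h' := (h + v * (1 - 2 * h))%R.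
have h'E : h' = hseq u k.+1 by [].
have h'2 : (h' < 2^-1)%R by rewrite h'E hseq_lt// ltnW.
rewrite mkE; set j := (m - k.+1)%N.
have ind0 w : (0 <= \1_(exceed j) w :> R)%R by rewrite indicE.
(* The power of 1 - 2 h' in [gseq] is turned back into the integral over block [j.+1], so that both
   sides carry the same partial sum and compare pointwise. *)
have := integral_past_expR_psum P z z_iid (Ncum I j) (I j.+1) (\1_(exceed j))
  h' (exceed_past j) ind0 h'2.
rewrite -NcumS [X in _ = X]muleC => /esym tE.
rewrite [X in _ <= _ * X]tE.
rewrite -ge0_integralZl//; last first.
  by apply/measurable_EFinP; exact: measurable_tilted.
rewrite /tilted; apply: ge0_le_integral => //.
- by apply/measurable_EFinP; exact: measurable_tilted.
- by apply/measurable_EFinP/measurable_funM => //; exact: measurable_tilted.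
(* Chernoff: on [zeta (j + 1)] the factor [expR (v (1 - 2 h) (S - r ^ 2))], with
   [S] the partial sum and [r] the radius of index [j + 1], is at least 1. *)
move=> w _; rewrite -EFinM lee_fin exceedS.
rewrite indicI/= -mulrA [leRHS]mulrCA; rewrite ler_wpM2l//.
rewrite -expRD indicE; case: (boolP (w \in _)) => [|_]; last by rewrite mul0r expR_ge0.
rewrite inE mul1r ler_expR /zeta/= -/(psum P z _ w) => Sw.
have /andP[v0 _] := u_adm k.+1 (ltnW km).
have := one_sub_hseq_gt0 k (ltnW (ltnW km)); rewrite -/h => h0.
have : (0 <= v * (1 - 2 * h) * (psum P z (Ncum I j.+1) w - r j.+1 ^+ 2))%R.
  by apply: mulr_ge0; [apply: mulr_ge0 => //; exact: ltW|rewrite subr_ge0 ltW].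
by rewrite /h'; lra.
Qed.

(** Chaining m - 1 steps from Q_0, the probability itself, leads to Q_(m-1), which [chi2_law_tilt]
    evaluates exactly because [Ncum I 1] is [I 1]. *)
Lemma exceed_bound : P (exceed m) <= bound m I r u.
Proof.
have tilt k : (k < m)%N ->
    P (exceed m) <= (gseq m I r u k)%:E * tilted (m - k) (hseq u k).
  elim: k => [|k IH] km; first by rewrite mul1e subn0 tilted0.
  by rewrite (le_trans (IH (ltnW km)))// tilted_step.
have m0 : (0 < m)%N by rewrite ltnW.
have := tilt m.-1; rewrite ltn_predL => /(_ m0) /le_trans; apply.
rewrite (_ : (m - m.-1)%N = 1%N); last by rewrite -{1}(prednK m0) subSnn.
have hm : (hseq u m.-1 < 2^-1)%R by rewrite hseq_lt// leq_pred.
have c0 : (0 < 1 - 2 * hseq u m.-1)%R by rewrite one_sub_hseq_gt0// leq_pred.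
have I10 : (0 < I 1)%N by rewrite I0.
have mS : measurable_fun setT (psum P z (I 1%N)).
  exact: (measurable_past P z _ _ (psum_past P z _)).
have := chi2_law_tilt P (I 1%N) _ (hseq u m.-1) `](r 1%N ^+ 2)%R, +oo[%classic
  mS (measurable_itv _) hm (psum_chi2_law P z z_iid (I 1%N) I10).
(* Since 1 - 2 h is positive, undoing the rescaling multiplies the threshold by it. *)
have -> : [set y | `](r 1%N ^+ 2)%R, +oo[%classic ((1 - 2 * hseq u m.-1)^-1 * y)%R] =
    `]((1 - 2 * hseq u m.-1) * r 1%N ^+ 2)%R, +oo[%classic.
  by apply/seteqP; split => y; rewrite /= !in_itv/= !andbT ltr_pdivlMl.
move=> tE; have -> : tilted 1 (hseq u m.-1) =
    ((1 - 2 * hseq u m.-1) `^ (- ((I 1%N)%:R / 2)))%:E *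
    chi2_tail (I 1%N) ((1 - 2 * hseq u m.-1) * r 1%N ^+ 2).
  rewrite -tE /tilted [RHS]integral_mkcond; apply: eq_integral => w _.
  have -> : exceed 1 = psum P z (I 1%N) @^-1` `](r 1%N ^+ 2)%R, +oo[%classic.
    by rewrite exceed1; apply/seteqP; split => v; rewrite /= in_itv/= andbT.
  rewrite patchE indicE (_ : Ncum I 1 = I 1%N); last by rewrite /Ncum big_nat1.
  by case: ifP; rewrite ?mul1r ?mul0r.
by rewrite muleA -EFinM powRN.
Qed.

End staircase_bound.

Theorem theorem3 (R : realType) (d : measure_display) (T : measurableType d)
  (P : probability T R) (z : nat -> {RV P >-> R})
  (m : nat) (I : nat -> nat) (r : nat -> R) :
  (2 <= m)%N ->
  iid_std_normal z ->
  (forall i, (1 <= i <= m)%N -> (0 < I i)%N) ->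
  (forall i, (1 <= i <= m)%N -> 0 < r i) ->
  (P (\bigcap_(i in [set i | (1 <= i <= m)%N]) zeta z I r i) <=
   ereal_inf [set bound m I r u | u in [set u | admissible m u]])%E.
Proof.
move=> m2 z_iid I0 _; apply/ereal_infP => _ [u u_adm <-].
exact: (exceed_bound P z m I r u m2 z_iid I0 u_adm).
Qed.
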